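(* Let $A$ be an affine cellular $k$-algebra with cell chain $0=J_0\subset J_1\subset\cdots\subset J_n=A$ and cell data $(B_i,\sigma_i,\Delta_i,\psi^{(i)},\alpha_i)$ such that for every $1\le i\le n$ the ideal $J_i/J_{i-1}$ of $A/J_{i-1}$ is idempotent and $\det(\psi^{(i)})$ is not a zero-divisor in $B_i$. Then the embedding $\Theta:A\to\widehat A$ of $A$ into its asymptotic algebra induces a fully faithful restriction functor $F:\mathcal T(\widehat A)\to A\text{-Mod}$ from the full subcategory $\mathcal T(\widehat A)$ of torsionless left $\widehat A$-modules to the category of left $A$-modules; that is, $\mathrm{Hom}_A(F(X),F(Y))=\mathrm{Hom}_{\widehat A}(X,Y)$ for all torsionless left $\widehat A$-modules $X,Y$.
   Context: Conventions. $k$ is a commutative Noetherian domain. A $k$-involution is a $k$-linear anti-automorphism whose square is the identity. An affine commutative $k$-algebra is a finitely generated commutative unital $k$-algebra. The element $0$ counts as a zero-divisor. An ideal $J$ is idempotent if $J^2=J$. Affine cell ideal. Let $A$ be a unital $k$-algebra with a $k$-involution $i$. A two-sided ideal $J$ with $i(J)=J$ is an affine cell ideal if (1) there are a free $k$-module $V$ of finite rank $d\ge1$ and a nonzero affine commutative $k$-algebra $B$ with $k$-involution $\sigma$ such that $\Delta:=V\otimes_kB$ is an $A$-$B$-bimodule whose right $B$-structure is induced by the regular module $B_B$; (2) there is an $A$-$A$-bimodule isomorphism $\alpha:J\to\Delta\otimes_B\Delta'$, where $\Delta'=B\otimes_kV$ is a $B$-$A$-bimodule with left $B$-structure induced by ${}_BB$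 and right $A$-structure $(b\otimes v)a:=\tau(i(a)(v\otimes b))$, $\tau$ the flip, such that, identifying $\Delta\otimes_B\Delta'$ with $V\otimes_kB\otimes_kV$, $\alpha(i(\alpha^{-1}(u\otimes b\otimes v)))=v\otimes\sigma(b)\otimes u$. $\Delta$ is the cell module of $J$. There is a $k$-bilinear $\psi:V\times V\to B$ with $\alpha(\alpha^{-1}(u\otimes b\otimes v)\,\alpha^{-1}(u'\otimes b'\otimes v'))=u\otimes b\psi(v,u')b'\otimes v'$. Fix a basis $v_1,\dots,v_d$ of $V$; the swich matrix is $\psi=(\psi(v_r,v_s))_{r,s}\in M_d(B)$. Identifying $v_r\otimes b\otimes v_s$ with $bE_{rs}$, $\alpha$ becomes a bijection $J\to M_d(B)$ with $\alpha(xy)=\alpha(x)\psi\alpha(y)$. $(B,\sigma,\Delta,\psi,\alpha)$ is the cell datum of $J$. Affine cellular algebra. $A$ (with $i$) is affine cellular if $A=J_1'\oplus\cdots\oplus J_n'$ as $k$-modules with $i(J_j')=J_j'$, such that the $J_j=\bigoplus_{l\le j}J_l'$ form a chain of two-sided ideals $0=J_0\subset J_1\subset\cdots\subset J_n=A$ (cell chain) and each $J_j/J_{j-1}$ is an affine cell ideal of $A/J_{j-1}$ (for the induced involution), with cell datum $(B_j,\sigma_j,\Delta_j,\psi^{(j)},\alpha_j)$; $d_j=\mathrm{rank}_{B_j}(\Delta_j)$. The asymptotic algebra is the ring $\widehat A=M_{d_n}(B_n)\times\cdots\times M_{d_1}(B_1)$ with ordinary matrix multiplication. Embedding and restriction.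 If no $\det(\psi^{(j)})$ is a zero-divisor, $\Theta:A\to\widehat A$, $\Theta(a)=(\alpha_n(ae_n),\ldots,\alpha_1(ae_1))$ with $e_j=\alpha_j^{-1}(\mathbf I_{d_j})\in J_j/J_{j-1}$, is an injective ring homomorphism. For a left $\widehat A$-module $X$, $F(X)$ is the abelian group $X$ with $A$-action $a\cdot x=\Theta(a)x$; $F$ is the identity on maps. A module is torsionless (in the sense used here) if it embeds into a projective (equivalently, free) module. *)

(* Defs.v *)
From HB Require Import structures.
From mathcomp Require Import all_boot all_order all_algebra.

Set Implicit Arguments.
Unset Strict Implicit.
Unset Printing Implicit Defensive.

Import GRing.Theory.
Local Open Scope ring_scope.

Definition noetherian (k : comNzRingType) : Prop :=
  forall I : k -> Prop,
    I 0 -> (forall x y, I x -> I y -> I (x + y)) ->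
    (forall c x, I x -> I (c * x)) ->
    exists (m : nat) (g : 'I_m -> k),
      forall x, I x <-> exists c : 'I_m -> k, x = \sum_s c s * g s.

Section Algebras.
Variables (k : comNzRingType) (A : algType k).

Definition k_involution (i : A -> A) : Prop :=
  [/\ forall c x y, i (c *: x + y) = c *: i x + i y,
      forall x y, i (x * y) = i y * i x
    & forall x, i (i x) = x].

Definition k_submodule (S : A -> Prop) : Prop :=
  [/\ S 0, forall x y, S x -> S y -> S (x + y)
    & forall (c : k) x, S x -> S (c *: x)].

Definition two_sided_ideal (J : A -> Prop) : Prop :=
  [/\ J 0, forall x y, J x -> J y -> J (x + y),
      forall a x, J x -> J (a * x) & forall a x, J x -> J (x * a)].

(* i(S) = S *)
Definition fixed_by (i : A -> A) (S : A -> Prop) : Prop :=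
  forall y, S y <-> exists2 x, S x & i x = y.

(* J^2 consists of the finite sums of products of two elements of J. *)
Definition idempotent_ideal (J : A -> Prop) : Prop :=
  forall a, J a <->
    exists (m : nat) (x y : 'I_m -> A),
      [/\ forall s, J (x s), forall s, J (y s) & a = \sum_s x s * y s].

Definition fin_generated_algebra : Prop :=
  exists g : seq A, forall S : A -> Prop,
    S 1 -> k_submodule S -> (forall x y, S x -> S y -> S (x * y)) ->
    (forall x, x \in g -> S x) -> forall x, S x.

End Algebras.

(* As R is nonzero, 0 is a zero-divisor (take c := 1). *)
Definition zero_divisor (R : comNzRingType) (b : R) : Prop :=
  exists2 c : R, c != 0 & b * c = 0.

(* A free k-module of rank d with a fixed basis v; [coord u] is the row of
   coordinates of u. *)
Record based_module (k : comNzRingType) (d : nat) := BasedModule {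
  bm_sort :> lmodType k;
  bm_basis : 'I_d -> bm_sort;
  bm_coord : bm_sort -> 'rV[k]_d;
  bm_coordK : forall u, \sum_r bm_coord u 0 r *: bm_basis r = u;
  bm_coord_sum : forall c : 'rV[k]_d,
    bm_coord (\sum_r c 0 r *: bm_basis r) = c
}.

(* For V free with basis v_1, ..., v_d the tensor products are realised as
     V (x)_k B               = 'cV[B]_d,   v_r (x) b           = b e_r,
     B (x)_k V               = 'rV[B]_d,   b (x) v_s           = b e_s^T,
     (V (x) B) (x)_B (B (x) V) = 'M[B]_d,  x (x)_B y           = x *m y,
     V (x)_k B (x)_k V       = 'M[B]_d,    v_r (x) b (x) v_s   = b E_rs,
   so that the flip V (x) B <-> B (x) V is transposition. *)
Section Tensors.
Variables (k : comNzRingType) (d : nat) (V : based_module k d).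
Variable (B : comAlgType k).

Definition tensVB (u : V) (b : B) : 'cV[B]_d :=
  \col_r (bm_coord u 0 r *: b).

Definition tensBV (b : B) (v : V) : 'rV[B]_d :=
  \row_s (bm_coord v 0 s *: b).

Definition tensVBV (u : V) (b : B) (v : V) : 'M[B]_d :=
  tensVB u b *m tensBV 1 v.

End Tensors.

(* [act] makes B^d, with its standard B-module structure, an A-B-bimodule on
   which the two induced actions of k agree. *)
Definition bimodule_action (k : comNzRingType) (A : algType k)
    (B : comAlgType k) (d : nat) (act : A -> 'cV[B]_d -> 'cV[B]_d) : Prop :=
  [/\ (forall x, act 1 x = x) /\
      (forall a a' x, act (a * a') x = act a (act a' x)),
      forall a a' x, act (a + a') x = act a x + act a' x,
      forall a x y, act a (x + y) = act a x + act a y,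
      forall a (b : B) x, act a (b *: x) = b *: act a x
    & forall (c : k) a x, act (c *: a) x = (c%:A : B) *: act a x].

(* [act] is the left A-structure of Delta = 'cV[B]_d.  Delta' = 'rV[B]_d then
   has the right A-structure y . a = (i(a) . y^T)^T.
   [alpha] is only meaningful on J, where [alphaV] is its inverse.  The
   A-A-bimodule structure of Delta (x)_B Delta' is determined by
   a (x (x) y) = (a x) (x) y and (x (x) y) a = x (x) (y a). *)
Record affine_cell_ideal (k : comNzRingType) (A : algType k) (i : A -> A)
    (J : A -> Prop) := AffineCellIdeal {
  aci_ideal : two_sided_ideal J;
  aci_fixed : fixed_by i J;
  aci_d : nat;
  aci_d_gt0 : (0 < aci_d)%N;
  aci_V : based_module k aci_d;
  aci_B : comAlgType k;
  aci_B_affine : fin_generated_algebra aci_B;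
  aci_sigma : aci_B -> aci_B;
  aci_sigmaP : k_involution aci_sigma;
  aci_act : A -> 'cV[aci_B]_aci_d -> 'cV[aci_B]_aci_d;
  aci_actP : bimodule_action aci_act;
  aci_alpha : A -> 'M[aci_B]_aci_d;
  aci_alphaV : 'M[aci_B]_aci_d -> A;
  aci_alphaV_in : forall M, J (aci_alphaV M);
  aci_alphaK : forall p, J p -> aci_alphaV (aci_alpha p) = p;
  aci_alphaVK : forall M, aci_alpha (aci_alphaV M) = M;
  aci_alphaD : forall p q, J p -> J q ->
    aci_alpha (p + q) = aci_alpha p + aci_alpha q;
  aci_alpha_left : forall a (x : 'cV_aci_d) (y : 'rV_aci_d),
    aci_alpha (a * aci_alphaV (x *m y)) = aci_act a x *m y;
  aci_alpha_right : forall a (x : 'cV_aci_d) (y : 'rV_aci_d),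
    aci_alpha (aci_alphaV (x *m y) * a) = x *m (aci_act (i a) y^T)^T;
  aci_alpha_inv : forall (u : aci_V) (b : aci_B) (v : aci_V),
    aci_alpha (i (aci_alphaV (tensVBV u b v))) = tensVBV v (aci_sigma b) u;
  (* The bilinear form is uniquely determined by, and always exists for, the
     preceding data. *)
  aci_form : aci_V -> aci_V -> aci_B;
  aci_form_linl : forall v, linear (aci_form ^~ v);
  aci_form_linr : forall u, linear (aci_form u);
  aci_alphaM : forall (u u' v v' : aci_V) (b b' : aci_B),
    aci_alpha (aci_alphaV (tensVBV u b v) * aci_alphaV (tensVBV u' b' v'))
    = tensVBV u (b * aci_form v u' * b') v'
}.

Arguments aci_sigma {k A i J} _ _.
Arguments aci_act {k A i J} _ _ _.
Arguments aci_alpha {k A i J} _ _.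
Arguments aci_alphaV {k A i J} _ _.
Arguments aci_form {k A i J} _ _ _.

Definition swich (k : comNzRingType) (A : algType k) (i : A -> A)
    (J : A -> Prop) (C : affine_cell_ideal i J) : 'M[aci_B C]_(aci_d C) :=
  \matrix_(r, s) aci_form C (bm_basis (aci_V C) r) (bm_basis (aci_V C) s).

(* The m-th term of the chain attached to J'_1, ..., J'_n (the pieces being
   indexed from 0 here): the sum of the first m pieces. *)
Definition chain_term (k : comNzRingType) (A : algType k) (n : nat)
    (P : 'I_n -> A -> Prop) (m : nat) (a : A) : Prop :=
  exists2 x : 'I_n -> A, forall l, P l (x l) &
    a = \sum_(l < n | (l < m)%N) x l.

Definition image_pred (T U : Type) (f : T -> U) (S : T -> Prop) (y : U) : Prop :=
  exists2 x, S x & f x = y.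

(* The layers are J_{j+1} / J_j for 0 <= j < n.  The quotient algebra A / J_j is
   given by any algebra together with a surjective algebra morphism from A with
   kernel J_j. *)
Record affine_cellular (k : comNzRingType) (A : algType k) (i : A -> A) :=
  AffineCellular {
  ac_n : nat;
  ac_part : 'I_ac_n -> A -> Prop;
  ac_part_submod : forall j, k_submodule (ac_part j);
  ac_part_direct : forall a, exists! x : {ffun 'I_ac_n -> A},
    (forall j, ac_part j (x j)) /\ a = \sum_j x j;
  ac_part_fixed : forall j, fixed_by i (ac_part j);
  ac_chain_ideal : forall m, (m <= ac_n)%N ->
    two_sided_ideal (chain_term ac_part m);
  ac_quot : 'I_ac_n -> algType k;
  ac_proj : forall j, {lrmorphism A -> ac_quot j};
  ac_proj_surj : forall j (q : ac_quot j), exists a, ac_proj j a = q;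
  ac_proj_ker : forall j a, ac_proj j a = 0 <-> chain_term ac_part j a;
  ac_quot_inv : forall j, ac_quot j -> ac_quot j;
  ac_quot_invE : forall j a, ac_quot_inv (ac_proj j a) = ac_proj j (i a);
  ac_cell : forall j, affine_cell_ideal (@ac_quot_inv j)
    (image_pred (ac_proj j) (chain_term ac_part j.+1))
}.

Arguments ac_part {k A i} _ _ _.

(* The ideal J_{j+1} / J_j of A / J_j. *)
Definition layer (k : comNzRingType) (A : algType k) (i : A -> A)
    (D : affine_cellular i) (j : 'I_(ac_n D)) : ac_quot j -> Prop :=
  image_pred (ac_proj j) (chain_term (ac_part D) j.+1).

(* Direct product of a finite family of rings. *)
Definition ring_prod (I : finType) (R : I -> pzRingType) : Type :=
  {dffun forall j : I, R j}.

Section RingProd.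
Variables (I : finType) (R : I -> pzRingType).
Local Notation P := (ring_prod R).

HB.instance Definition _ := Choice.on P.

Let zero : P := [ffun j => 0 : R j].
Let one : P := [ffun j => 1 : R j].
Let opp (x : P) : P := [ffun j => - x j : R j].
Let add (x y : P) : P := [ffun j => x j + y j : R j].
Let mul (x y : P) : P := [ffun j => x j * y j : R j].

Fact ring_prod_addA : associative add.
Proof. by move=> x y z; apply/ffunP=> j; rewrite !ffunE addrA. Qed.
Fact ring_prod_addC : commutative add.
Proof. by move=> x y; apply/ffunP=> j; rewrite !ffunE addrC. Qed.
Fact ring_prod_add0 : left_id zero add.
Proof. by move=> x; apply/ffunP=> j; rewrite !ffunE add0r. Qed.
Fact ring_prod_addN : left_inverse zero opp add.
Proof. by move=> x; apply/ffunP=> j; rewrite !ffunE addNr. Qed.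
HB.instance Definition _ := GRing.isZmodule.Build P
  ring_prod_addA ring_prod_addC ring_prod_add0 ring_prod_addN.

Fact ring_prod_mulA : associative mul.
Proof. by move=> x y z; apply/ffunP=> j; rewrite !ffunE mulrA. Qed.
Fact ring_prod_mul1x : left_id one mul.
Proof. by move=> x; apply/ffunP=> j; rewrite !ffunE mul1r. Qed.
Fact ring_prod_mulx1 : right_id one mul.
Proof. by move=> x; apply/ffunP=> j; rewrite !ffunE mulr1. Qed.
Fact ring_prod_mulDl : left_distributive mul +%R.
Proof. by move=> x y z; apply/ffunP=> j; rewrite !ffunE mulrDl. Qed.
Fact ring_prod_mulDr : right_distributive mul +%R.
Proof. by move=> x y z; apply/ffunP=> j; rewrite !ffunE mulrDr. Qed.
HB.instance Definition _ := GRing.Zmodule_isPzRing.Build P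
  ring_prod_mulA ring_prod_mul1x ring_prod_mulx1
  ring_prod_mulDl ring_prod_mulDr.

End RingProd.

Section Asymptotic.
Variables (k : comNzRingType) (A : algType k) (i : A -> A).
Variable (D : affine_cellular i).

(* The index j : 'I_n corresponds to the layer J_{j+1} / J_j, so the factors
   are listed in the reverse of the customary order M_{d_n}, ..., M_{d_1}. *)
Definition asymptotic : pzRingType :=
  ring_prod (fun j : 'I_(ac_n D) => 'M[aci_B (ac_cell j)]_(aci_d (ac_cell j))).

Definition Theta (a : A) : asymptotic :=
  [ffun j : 'I_(ac_n D) =>
     aci_alpha (ac_cell j) (ac_proj j a * aci_alphaV (ac_cell j) 1%:M)
     : 'M[aci_B (ac_cell j)]_(aci_d (ac_cell j))].

End Asymptotic.

Section Restriction.
Variables (S R : pzRingType) (theta : {rmorphism S -> R}).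

Definition restrict of {rmorphism S -> R} := fun X : lmodType R => X : Type.

Section Object.
Variable X : lmodType R.
Local Notation FX := (restrict theta X).

HB.instance Definition _ := GRing.Zmodule.on FX.

Let scale (a : S) (x : FX) : FX := theta a *: (x : X).

Fact restrict_scaleA a b x : scale a (scale b x) = scale (a * b) x.
Proof. by rewrite /scale scalerA rmorphM. Qed.
Fact restrict_scale1 : left_id 1 scale.
Proof. by move=> x; rewrite /scale rmorph1 scale1r. Qed.
Fact restrict_scaleDr : right_distributive scale +%R.
Proof. by move=> a x y; rewrite /scale; exact: scalerDr. Qed.
Fact restrict_scaleDl x : {morph scale^~ x : a b / a + b}.
Proof. by move=> a b; rewrite /scale rmorphD; exact: scalerDl. Qed.
HB.instance Definition _ := GRing.Zmodule_isLmodule.Build S FX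
  restrict_scaleA restrict_scale1 restrict_scaleDr restrict_scaleDl.

End Object.

Section Map.
Variables (X Y : lmodType R) (f : {linear X -> Y}).

Definition restrict_fun (x : restrict theta X) : restrict theta Y := f x.

Fact restrict_fun_linear : linear restrict_fun.
Proof. by move=> a x y; exact: (linearP f (theta a) x y). Qed.
HB.instance Definition _ := GRing.isLinear.Build S
  (restrict theta X) (restrict theta Y) *:%R restrict_fun restrict_fun_linear.

Definition restrict_map : {linear restrict theta X -> restrict theta Y} :=
  restrict_fun.

End Map.

(* [restrict_map] does not change the underlying function, so its bijectivity
   says that X and Y have the same S-linear and R-linear maps. *)
Definition restriction_fully_faithful_on (T : lmodType R -> Prop) : Prop :=
  forall X Y : lmodType R, T X -> T Y -> bijective (@restrict_map X Y).

End Restriction.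

Definition projective (R : pzRingType) (P : lmodType R) : Prop :=
  forall (M N : lmodType R) (g : {linear M -> N}) (f : {linear P -> N}),
    (forall y, exists x, g x = y) ->
    exists h : {linear P -> M}, forall x, g (h x) = f x.

Definition torsionless (R : pzRingType) (X : lmodType R) : Prop :=
  exists (P : lmodType R) (f : {linear X -> P}), projective P /\ injective f.

(* Main.v *)
(** Write rho_j : A -> M_{d_j}(B_j) for the j-th component of Theta.  If
    alpha_j(a) = N then rho_j(a) = N psi_j, and Theta(a) vanishes at the layers
    above j.  Let f be A-linear and, by induction, linear for the factors l < j
    of the asymptotic algebra; then f commutes with every N psi_j in the factor
    j.  Idempotence of the layer gives 1 = sum_s M_s psi_j N_s, whence
    f(T x) = T f(1_j x) for all T in the factor j, where 1_j is its unit: move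
    each T M_s psi_j out of f and each M_s psi_j back in.  With T = psi_j this
    gives psi_j f(1_j x) = f(psi_j x) = psi_j f(x), and psi_j can be cancelled
    because its determinant acts injectively on a torsionless target. *)
From HB Require Import structures.
From Stdlib Require Import FunctionalExtensionality ProofIrrelevance.
Require Import Defs.
From mathcomp Require Import all_boot all_order all_algebra.
From mathcomp Require Import finmap.
From mathcomp.multinomials Require Import monalg.

Set Implicit Arguments.
Unset Strict Implicit.
Unset Printing Implicit Defensive.

Import GRing.Theory.
Local Open Scope ring_scope.

(** * Annihilators in projective and torsionless modules *)

Section LinearCombination.

Variables (R : nzRingType) (X : lmodType R).

(** [{malg R[X]}] is the free module on the underlying set of [X]; this is its canonical surjection
    onto [X]. *)
Definition lincomb (g : {malg R[X]}) : X := \sum_(x <- msupp g) g@_x *: x.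

Lemma lincombEw (S : {fset X}) (g : {malg R[X]}) : (msupp g `<=` S)%fset ->
  lincomb g = \sum_(x <- S) g@_x *: x.
Proof.
move=> sgS; rewrite /lincomb (big_fset_incl _ sgS) // => x _ /mcoeff_outdom->.
by rewrite scale0r.
Qed.

Lemma lincomb_is_linear : linear lincomb.
Proof.
move=> c g h; pose S := (msupp g `|` msupp h)%fset.
have sgS : (msupp g `<=` S)%fset by exact: fsubsetUl.
have shS : (msupp h `<=` S)%fset by exact: fsubsetUr.
rewrite (lincombEw sgS) (lincombEw shS) (@lincombEw S); last first.
  by apply: fsubset_trans (msuppD_le _ _) (fsetSU _ (msuppZ_le _ _)).
rewrite scaler_sumr -big_split; apply: eq_bigr => x _ /=.
by rewrite mcoeffD mcoeffZ scalerDl scalerA.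
Qed.

HB.instance Definition _ :=
  GRing.isLinear.Build R {malg R[X]} X *:%R lincomb lincomb_is_linear.

Lemma lincombU x : lincomb << 1 *g x >> = x.
Proof.
by rewrite (lincombEw msuppU_le) big_seq_fset1 mcoeffUU scale1r.
Qed.

(** Projectivity gives a section [h] of [lincomb], so [X] embeds into a free module, where the
    implication is checked on each coordinate in [R]. *)
Lemma projective_annihilator_nz (c e : R) : projective X ->
  (forall r, c * r = 0 -> e * r = 0) -> forall x : X, c *: x = 0 -> e *: x = 0.
Proof.
move=> Xproj ce x cx0.
have [|h hK] := Xproj _ _ (lincomb : {linear {malg R[X]} -> X})
  (idfun : {linear X -> X}).
  by move=> y; exists << 1 *g y >>; rewrite /= lincombU.
rewrite -[x]/(idfun x) -hK -!linearZ_LR /= linearZ_LR.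
suff -> : e *: h x = 0 by rewrite linear0.
apply/malgP => y; rewrite mcoeff0 mcoeffZ; apply: ce.
by rewrite -mcoeffZ -linearZ_LR cx0 linear0 mcoeff0.
Qed.

End LinearCombination.

(* The trivial ring is split off because {malg R[X]}, the free module that maps
   onto X, is an R-module only for nontrivial R. *)
Lemma projective_annihilator (R : pzRingType) (X : lmodType R) (c e : R) :
  projective X ->
  (forall r, c * r = 0 -> e * r = 0) -> forall x : X, c *: x = 0 -> e *: x = 0.
Proof.
have [R0 _ _ x _|R1] := eqVneq (1 : R) 0.
  by rewrite -[e]mul1r R0 mul0r scale0r.
case: R X c e R1 => R cR X c e R1.
pose R0 : pzRingType := GRing.PzRing.Pack cR.
pose m := GRing.PzSemiRing_isNonZero.Build R0 R1.
pose R' : nzRingType := HB.pack R cR m.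
exact: (@projective_annihilator_nz R' X c e).
Qed.

Lemma torsionless_annihilator (R : pzRingType) (X : lmodType R) (c e : R) :
  torsionless X ->
  (forall r, c * r = 0 -> e * r = 0) -> forall x : X, c *: x = 0 -> e *: x = 0.
Proof.
move=> [P [f [Pproj f_inj]]] ce x cx0; apply: f_inj.
rewrite linearZ_LR linear0; apply: (projective_annihilator Pproj ce).
by rewrite -linearZ_LR cx0 linear0.
Qed.

(** * Cancelling a matrix with regular determinant *)

Section MatrixRegular.
Variables (B : comNzRingType) (d : nat) (psi : 'M[B]_d).
Hypothesis psi_reg : ~ zero_divisor (\det psi).

Lemma det_regular_scale m n (M : 'M[B]_(m, n)) : \det psi *: M = 0 -> M = 0.
Proof.
move=> psiM0; apply/matrixP => r s; rewrite mxE; apply/eqP/negPn/negP => Mrs.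
case: psi_reg; exists (M r s) => //.
by have := congr1 (fun N : 'M_(m, n) => N r s) psiM0; rewrite !mxE.
Qed.

(** Multiplying by the adjugate turns [psi] into the scalar [\det psi], which cancels entry by
    entry. *)
Lemma det_regular_mull n (M : 'M[B]_(d, n)) : psi *m M = 0 -> M = 0.
Proof.
move=> psiM0; apply: det_regular_scale.
by rewrite -mul_scalar_mx -mul_adj_mx -mulmxA psiM0 mulmx0.
Qed.

Lemma det_regular_mulr m (M : 'M[B]_(m, d)) : M *m psi = 0 -> M = 0.
Proof.
move=> Mpsi0; apply: det_regular_scale.
by rewrite -mul_mx_scalar -mul_mx_adj mulmxA Mpsi0 mul0mx.
Qed.

End MatrixRegular.

(** * The matrix representation on a cell module *)

Lemma coord_basis (k : comNzRingType) d (V : based_module k d) (r s : 'I_d) :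
  bm_coord (bm_basis V r) 0 s = (s == r)%:R.
Proof.
have := bm_coord_sum V (delta_mx 0 r).
rewrite (bigD1 r) //= big1 ?addr0 => [|t tr]; last first.
  by rewrite mxE (negPf tr) scale0r.
by rewrite mxE !eqxx scale1r => ->; rewrite mxE.
Qed.

Section Cell.
Variables (k : comNzRingType) (A : algType k) (i : A -> A) (J : A -> Prop).
Variable C : affine_cell_ideal i J.
Local Notation alpha := (@aci_alpha _ _ _ _ C).
Local Notation alphaV := (@aci_alphaV _ _ _ _ C).

(** The matrix by which [a] acts on the cell module, as [cell_actE] shows; [Theta] is built from
    these. *)
Definition cell_rep (a : A) : 'M[aci_B C]_(aci_d C) := alpha (a * alphaV 1%:M).

Lemma cell_mull a p : J p -> J (a * p).
Proof. by case: (aci_ideal C) => _ _ + _ => /[apply]. Qed.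

Lemma cell_alphaVD M N : alphaV (M + N) = alphaV M + alphaV N.
Proof.
have JD : J (alphaV M + alphaV N).
  by case: (aci_ideal C) => _ D _ _; apply: D; exact: aci_alphaV_in.
rewrite -(aci_alphaK C JD) aci_alphaD ?aci_alphaVK //; exact: aci_alphaV_in.
Qed.

Lemma cell_alpha0 : alpha 0 = 0.
Proof.
have J0 : J 0 by case: (aci_ideal C).
by apply: (addrI (alpha 0)); rewrite -aci_alphaD // !addr0.
Qed.

Lemma cell_alphaV0 : alphaV 0 = 0.
Proof. by apply: (addrI (alphaV 0)); rewrite -cell_alphaVD !addr0. Qed.

Lemma cell_alphaV_sum I (r : seq I) (F : I -> 'M_(aci_d C)) :
  alphaV (\sum_(s <- r) F s) = \sum_(s <- r) alphaV (F s).
Proof. exact: (big_morph _ cell_alphaVD cell_alphaV0). Qed.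

Lemma cell_alpha_sum I (r : seq I) (F : I -> A) : (forall s, J (F s)) ->
  alpha (\sum_(s <- r) F s) = \sum_(s <- r) alpha (F s).
Proof.
move=> JF; case: (aci_ideal C) => J0 JD _ _.
elim: r => [|s r IHr]; first by rewrite !big_nil cell_alpha0.
rewrite !big_cons aci_alphaD // ?IHr //.
by elim: {IHr} r => [|t r IHr]; rewrite (big_nil, big_cons) //; apply: JD.
Qed.

(** The field [aci_alpha_left] speaks of pure tensors only; splitting [M] into its columns reduces
    to them. *)
Lemma cell_alpha_mul_act a M :
  alpha (a * alphaV M) = \sum_s aci_act C a (col s M) *m delta_mx 0 s.
Proof.
have {1}-> : M = \sum_s col s M *m delta_mx 0 s.
  apply/matrixP => r t; rewrite summxE (bigD1 t) //= big1 ?addr0.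
    by rewrite mxE big_ord1 !mxE !eqxx mulr1.
  by move=> s st; rewrite mxE big_ord1 !mxE [t == s]eq_sym (negPf st) mulr0.
rewrite cell_alphaV_sum mulr_sumr cell_alpha_sum => [|s].
  by apply: eq_bigr => s _; rewrite aci_alpha_left.
by apply: cell_mull; exact: aci_alphaV_in.
Qed.

Lemma cell_actE a x : aci_act C a x = cell_rep a *m x.
Proof.
have [_ _ actD actZ _] := aci_actP C.
have act0 : aci_act C a 0 = 0.
  by apply: (addrI (aci_act C a 0)); rewrite -actD !addr0.
have {1}-> : x = \sum_s x s 0 *: col s 1%:M.
  apply/matrixP => r t; rewrite ord1 summxE (bigD1 r) //= big1 ?addr0.
    by rewrite !mxE eqxx mulr1.
  by move=> s sr; rewrite !mxE [r == s]eq_sym (negPf sr) mulr0.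
rewrite (big_morph _ (actD a) act0) /cell_rep cell_alpha_mul_act mulmx_suml.
apply: eq_bigr => s _; rewrite actZ -mulmxA.
rewrite [_ *m x](_ : _ = (x s 0)%:M) ?mul_mx_scalar //.
apply/matrixP => r t; rewrite !ord1 !mxE (bigD1 s) //= big1 ?addr0 => [|u us].
  by rewrite mxE !eqxx mul1r.
by rewrite mxE (negPf us) andbF mul0r.
Qed.

Lemma cell_alpha_mul a M : alpha (a * alphaV M) = cell_rep a *m M.
Proof.
rewrite cell_alpha_mul_act; apply/matrixP => r t.
rewrite summxE (bigD1 t) //= big1 ?addr0 => [|s st].
  rewrite cell_actE mxE big_ord1 !mxE !eqxx mulr1.
  by apply: eq_bigr => s _; rewrite mxE.
by rewrite mxE big_ord1 !mxE [t == s]eq_sym (negPf st) andbF mulr0.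
Qed.

Lemma cell_repD : {morph cell_rep : a b / a + b}.
Proof.
move=> a b; rewrite /cell_rep mulrDl aci_alphaD //;
by apply: cell_mull; exact: aci_alphaV_in.
Qed.

Lemma cell_rep0 : cell_rep 0 = 0.
Proof. by rewrite /cell_rep mul0r cell_alpha0. Qed.

Lemma cell_repM a b : cell_rep (a * b) = cell_rep a *m cell_rep b.
Proof.
rewrite -cell_alpha_mul /cell_rep aci_alphaK ?mulrA //.
by apply: cell_mull; exact: aci_alphaV_in.
Qed.

Lemma cell_rep1 : cell_rep 1 = 1%:M.
Proof. by rewrite /cell_rep mul1r aci_alphaVK. Qed.

Lemma tensVBV_basis r (b : aci_B C) s :
  tensVBV (bm_basis (aci_V C) r) b (bm_basis (aci_V C) s) = b *: delta_mx r s.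
Proof.
apply/matrixP => t u; rewrite mxE big_ord1 !mxE !coord_basis.
by case: (t == r); case: (u == s);
  rewrite ?(scale1r, scale0r, mulr1, mul0r, mulr0).
Qed.

(** By additivity it is enough to treat [b E_rt]. Writing the identity as the sum of the [E_ss], the
    product rule [aci_alphaM] yields the terms [b psi_ts E_rs], whose sum over [s] is
    [b E_rt psi]. *)
Lemma cell_rep_alphaV N : cell_rep (alphaV N) = N *m swich C.
Proof.
suff step r t (b : aci_B C) :
    cell_rep (alphaV (b *: delta_mx r t)) = b *: delta_mx r t *m swich C.
  rewrite [N]matrix_sum_delta mulmx_suml cell_alphaV_sum.
  rewrite (big_morph _ cell_repD cell_rep0); apply: eq_bigr => r _.
  rewrite mulmx_suml cell_alphaV_sum (big_morph _ cell_repD cell_rep0).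
  by apply: eq_bigr => t _.
rewrite /cell_rep -tensVBV_basis (_ : 1%:M = \sum_s delta_mx s s); last first.
  apply/matrixP => u v; rewrite summxE (bigD1 u) //= big1 ?addr0.
    by rewrite !mxE eqxx eq_sym.
  by move=> s su; rewrite mxE [u == s]eq_sym (negPf su).
rewrite cell_alphaV_sum mulr_sumr cell_alpha_sum => [|s]; last first.
  by apply: cell_mull; exact: aci_alphaV_in.
under eq_bigr => s _.
  rewrite -[delta_mx s s]scale1r -tensVBV_basis aci_alphaM tensVBV_basis mulr1.
  over.
apply/matrixP => u v; rewrite summxE tensVBV_basis (bigD1 v) //= big1 ?addr0.
  rewrite !mxE (bigD1 t) //= big1 ?addr0 => [|s st].
    by rewrite !mxE !eqxx andbT; case: (u == r); rewrite ?(mulr1, mulr0, mul0r).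
  by rewrite !mxE (negPf st) andbF mulr0 mul0r.
by move=> s sv; rewrite !mxE [v == s]eq_sym (negPf sv) andbF mulr0.
Qed.

Lemma cell_alphaM p q : J p -> J q ->
  alpha (p * q) = alpha p *m swich C *m alpha q.
Proof.
move=> Jp Jq; rewrite -{1}(aci_alphaK C Jq) cell_alpha_mul.
by rewrite -{1}(aci_alphaK C Jp) cell_rep_alphaV.
Qed.

(** Idempotence writes [alphaV 1%:M] as a sum of products from [J]; applying [alpha] shows that the
    swich matrix generates the unit ideal of the matrix ring. *)
Lemma idempotent_swich : idempotent_ideal J ->
  exists m (M N : 'I_m -> 'M[aci_B C]_(aci_d C)),
    \sum_s M s *m swich C *m N s = 1%:M.
Proof.
move=> Jidem.
have [m [p [q [Jp Jq E]]]] := (Jidem _).1 (@aci_alphaV_in _ _ _ _ C 1%:M).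
exists m, (alpha \o p), (alpha \o q).
rewrite -[RHS]aci_alphaVK E cell_alpha_sum => [|s]; last exact: cell_mull.
by apply: eq_bigr => s _; rewrite cell_alphaM.
Qed.

(** In the coordinates [alpha], [cell_rep] on [J] is right multiplication by the swich matrix, which
    is injective. *)
Lemma cell_rep_inj : ~ zero_divisor (\det (swich C)) ->
  forall p, J p -> cell_rep p = 0 -> p = 0.
Proof.
move=> psi_reg p Jp; rewrite -(aci_alphaK C Jp) cell_rep_alphaV.
by move/(det_regular_mulr psi_reg)->; rewrite cell_alphaV0.
Qed.

End Cell.

(** * Reducing full faithfulness to linearity *)

(** Bundled linear maps also carry proofs, so Leibniz equality needs functional extensionality and
    proof irrelevance. *)
Lemma eq_linear (R : pzRingType) (U V : lmodType R) (f g : {linear U -> V}) :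
  f =1 g -> f = g.
Proof.
case: f g => f [[fA] [fZ]] [g [[gA] [gZ]]] /= /functional_extensionality fg.
case: g / fg in gA gZ *; rewrite (proof_irrelevance _ gA fA).
by rewrite (proof_irrelevance _ gZ fZ).
Qed.

(** The inverse keeps the underlying function, so only its linearity over [R] is at stake. *)
Lemma restrict_map_bij (S R : pzRingType) (theta : {rmorphism S -> R})
    (X Y : lmodType R) :
  (forall g : {linear restrict theta X -> restrict theta Y},
    linear (g : X -> Y)) ->
  bijective (@restrict_map S R theta X Y).
Proof.
move=> g_lin.
pose ext (g : {linear restrict theta X -> restrict theta Y}) :
    {linear X -> Y} :=
  HB.pack (g : X -> Y) (GRing.isLinear.Build _ X Y *:%R g (g_lin g)).
by exists ext => g; exact: eq_linear.
Qed.

(** * Elements supported on one factor of a product ring *)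

Section Single.
Variables (I : finType) (R : I -> pzRingType).
Implicit Types x y : ring_prod R.

Lemma ring_prodD x y j : (x + y) j = x j + y j. Proof. exact: ffunE. Qed.

Lemma ring_prodM x y j : (x * y) j = x j * y j. Proof. exact: ffunE. Qed.

Lemma ring_prod1 j : (1 : ring_prod R) j = 1. Proof. exact: ffunE. Qed.

Lemma ring_prod0 j : (0 : ring_prod R) j = 0. Proof. exact: ffunE. Qed.

Lemma ring_prod_sum K (r : seq K) (F : K -> ring_prod R) j :
  (\sum_(s <- r) F s) j = \sum_(s <- r) F s j.
Proof.
exact: (big_morph (fun x => x j) (fun x y => ring_prodD x y j) (ring_prod0 j)).
Qed.

(** [dfwith] overwrites the zero family at [j] without an explicit cast along [l = j]. *)
Definition single j (a : R j) : ring_prod R :=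
  [ffun l => dfwith (fun l => 0 : R l) a l].

Lemma single_in j (a : R j) : single a j = a.
Proof. by rewrite ffunE dfwith_in. Qed.

Lemma single_out j l (a : R j) : l != j -> single a l = 0.
Proof. by rewrite eq_sym => lj; rewrite ffunE dfwith_out. Qed.

Lemma singleD j : {morph @single j : a b / a + b}.
Proof.
move=> a b; apply/ffunP => l; rewrite ring_prodD.
have [->|lj] := eqVneq l j; first by rewrite !single_in.
by rewrite !single_out ?addr0.
Qed.

Lemma single0 j : single (0 : R j) = 0.
Proof. by apply: (addrI (single (0 : R j))); rewrite -singleD !addr0. Qed.

Lemma mul_single j x (a : R j) : x * single a = single (x j * a).
Proof.
apply/ffunP => l; rewrite ring_prodM.
have [->|lj] := eqVneq l j; first by rewrite !single_in.
by rewrite !single_out ?mulr0.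
Qed.

Lemma mulr_single j x (a : R j) : single a * x = single (a * x j).
Proof.
apply/ffunP => l; rewrite ring_prodM.
have [->|lj] := eqVneq l j; first by rewrite !single_in.
by rewrite !single_out ?mul0r.
Qed.

Lemma singleM j (a b : R j) : single (a * b) = single a * single b.
Proof. by rewrite mul_single single_in. Qed.

Lemma sum_single x : x = \sum_j single (x j).
Proof.
apply/ffunP => j; rewrite ring_prod_sum (bigD1 j) //= single_in big1 ?addr0 //.
by move=> l lj; rewrite single_out // eq_sym.
Qed.

End Single.

(** * [Theta] and the layers of the cell chain *)

Section Layers.
Variables (k : comNzRingType) (A : algType k) (i : A -> A).
Variable D : affine_cellular i.

Lemma chain_term_mono m m' a : (m <= m')%N ->
  chain_term (ac_part D) m a -> chain_term (ac_part D) m' a.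
Proof.
move=> mm' [x Px ->].
(* Components from [m] on are set to 0, so enlarging the range of summation adds nothing. *)
exists (fun l : 'I__ => if (l < m)%N then x l else 0) => [l|].
  by case: ifP => // _; case: (ac_part_submod l).
rewrite -big_mkcondr /=; apply: eq_bigl => l.
by case: ltnP => [lm|]; rewrite ?andbF // (leq_trans lm mm').
Qed.

Lemma ThetaE a (j : 'I_(ac_n D)) :
  Theta D a j = cell_rep (ac_cell j) (ac_proj j a).
Proof. by rewrite ffunE. Qed.

Lemma Theta_additive : nmod_morphism (@Theta k A i D).
Proof.
split=> [|a b]; apply/ffunP => j.
  by rewrite ThetaE ring_prod0 raddf0 cell_rep0.
by rewrite ring_prodD !ThetaE raddfD cell_repD.
Qed.

Lemma Theta_multiplicative : monoid_morphism (@Theta k A i D).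
Proof.
split=> [|a b]; apply/ffunP => j.
  by rewrite ThetaE ring_prod1 rmorph1 cell_rep1.
by rewrite ring_prodM !ThetaE rmorphM cell_repM.
Qed.

HB.instance Definition _ :=
  GRing.isNmodMorphism.Build A (asymptotic D) (@Theta k A i D) Theta_additive.
HB.instance Definition _ :=
  GRing.isMonoidMorphism.Build A (asymptotic D) (@Theta k A i D)
    Theta_multiplicative.

Definition block j (N : 'M[aci_B (ac_cell j)]_(aci_d (ac_cell j))) :
  asymptotic D := @single _ _ j N.

Lemma blockM j M N : @block j (M *m N) = block M * block N.
Proof. exact: singleM. Qed.

Lemma block_sum j I (r : seq I) F :
  @block j (\sum_(s <- r) F s) = \sum_(s <- r) block (F s).
Proof. exact: (big_morph _ (@singleD _ _ j) (single0 _ j)). Qed.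

Lemma sum_block (x : asymptotic D) : x = \sum_j @block j (x j).
Proof. exact: sum_single. Qed.

(** Prepares the use of [torsionless_annihilator], with the swich block as [c] and the unit of the
    factor as [e]. *)
Lemma block_swich_cancel j (r : asymptotic D) :
    ~ zero_divisor (\det (swich (ac_cell j))) ->
  block (swich (ac_cell j)) * r = 0 -> @block j 1%:M * r = 0.
Proof.
move=> psi_reg; rewrite /block !mulr_single => psir0.
have /(det_regular_mull psi_reg) rj0 : swich (ac_cell j) *m r j = 0.
  have := congr1 (fun x : asymptotic D => x j) psir0.
  by rewrite single_in ring_prod0.
rewrite [_ * _](_ : _ = 0) ?single0 //; rewrite -[LHS]/(1%:M *m r j).
by rewrite rj0 mulmx0.
Qed.

(** A lift [a] of [alphaV N] can be taken in the chain term [j.+1]. Then [Theta D a] vanishes in the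
    factors above [j], while those below are not controlled and stay in the sum. *)
Lemma Theta_lift (j : 'I_(ac_n D))
    (N : 'M[aci_B (ac_cell j)]_(aci_d (ac_cell j))) :
  exists a, Theta D a =
    block (N *m swich (ac_cell j))
    + \sum_(l < ac_n D | (l < j)%N) block (Theta D a l).
Proof.
have [a Ja ja] := @aci_alphaV_in _ _ _ _ (ac_cell j) N.
exists a; rewrite {1}[Theta D a]sum_block.
rewrite (bigID (fun l : 'I__ => (l < j)%N)) /= addrC.
congr (_ + _); rewrite (bigD1 j) ?ltnn //= big1 ?addr0 => [|l].
  by rewrite ThetaE ja cell_rep_alphaV.
rewrite -leqNgt => /andP[jl lj]; rewrite ThetaE.
(* Here [j < l], so the chain term [j.+1] lies in the kernel of [ac_proj l]. *)
have -> : ac_proj l a = 0.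
  apply/ac_proj_ker; apply: chain_term_mono Ja.
  by rewrite ltn_neqAle jl eq_sym lj.
by rewrite cell_rep0; exact: single0.
Qed.

Hypothesis D_det : forall j : 'I_(ac_n D),
  ~ zero_divisor (\det (swich (ac_cell j))).

Lemma Theta_inj : injective (@Theta k A i D).
Proof.
apply: raddf_inj => a Ta0.
(* Descent along the chain: with [m] layers stripped from the top, [a] lies in the term
   [ac_n D - m], and [cell_rep_inj] strips the next layer. *)
have chain m : (m <= ac_n D)%N -> chain_term (ac_part D) (ac_n D - m) a.
  elim: m => [_|m IHm mn].
    have [x [[Px ->] _]] := @ac_part_direct _ _ _ D a; rewrite subn0.
    by exists x => //; apply: eq_bigl => l; rewrite ltn_ord.
  have jn : (ac_n D - m.+1 < ac_n D)%N by rewrite ltn_subrL (leq_trans _ mn).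
  pose j := Ordinal jn; apply/(ac_proj_ker j).
  apply: (cell_rep_inj (C := ac_cell j) (D_det (j := j))).
    by exists a => //; rewrite /= subnSK //; apply: IHm; exact: ltnW.
  by rewrite -ThetaE Ta0 ring_prod0.
have := chain _ (leqnn _); rewrite subnn => -[x _ ->].
by rewrite big_pred0.
Qed.

(** * Linearity over the asymptotic algebra *)

Hypothesis D_idem : forall j : 'I_(ac_n D), idempotent_ideal (@layer k A i D j).

Variables (X Y : lmodType (asymptotic D)) (f : {additive X -> Y}).
Hypothesis Y_torsionless : torsionless Y.
Hypothesis f_lin : forall a x, f (Theta D a *: x) = Theta D a *: f x.

Lemma block_linear (j : 'I_(ac_n D)) T x :
  f (@block j T *: x) = block T *: f x.
Proof.
(* Strong induction on the layer: the claim is available for all factors [l < j]. *)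
have [m] := ubnP (j : nat); elim: m => // m IHm in j T x *.
rewrite ltnS => jm.
(* [Theta_lift] expresses this block as [Theta D a] minus blocks at layers below [j]; [f_lin]
   handles the former, induction the latter. *)
have f_psi N z : f (block (N *m swich (ac_cell j)) *: z)
    = block (N *m swich (ac_cell j)) *: f z.
  have [a /esym/(canRL (addrK _)) ->] := Theta_lift N.
  rewrite !scalerBl raddfB /= f_lin !scaler_suml raddf_sum /=; congr (_ - _).
  by apply: eq_bigr => l lj; apply: IHm; apply: leq_trans lj jm.
have [n [M [N MpsiN]]] := @idempotent_swich _ _ _ _ (ac_cell j) (@D_idem j).
(* Through [1 = sum_s M_s psi N_s] both sides expand to the same sum, in which [f] is applied to
   [N_s z]. *)
have f_eps U z : f (@block j U *: z) = block U *: f (@block j 1%:M *: z).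
  have UE : U = \sum_s U *m M s *m swich (ac_cell j) *m N s.
    rewrite -[LHS]mulmx1 -MpsiN mulmx_sumr.
    by apply: eq_bigr => s _; rewrite !mulmxA.
  have -> : block U *: f (@block j 1%:M *: z)
      = \sum_s block (U *m M s *m swich (ac_cell j)) *: f (block (N s) *: z).
    rewrite -{1}MpsiN block_sum scaler_suml raddf_sum scaler_sumr.
    apply: eq_bigr => s _ /=.
    by rewrite blockM -!scalerA f_psi scalerA -blockM mulmxA.
  rewrite {1}UE block_sum scaler_suml raddf_sum.
  by apply: eq_bigr => s _ /=; rewrite blockM -scalerA f_psi.
rewrite f_eps -[T in LHS]mulmx1 blockM -scalerA.
suff -> : @block j 1%:M *: f (@block j 1%:M *: x) = @block j 1%:M *: f x.
  by rewrite scalerA -blockM mulmx1.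
apply/eqP; rewrite -subr_eq0 -scalerBr; apply/eqP.
(* It suffices that the swich block kills the difference. *)
apply: (torsionless_annihilator Y_torsionless
  (fun r => @block_swich_cancel j r (@D_det j))).
rewrite scalerBr; apply/eqP; rewrite subr_eq0; apply/eqP.
(* Both sides equal [f (psi x)], by [f_psi] with [N = 1]. *)
by rewrite -[swich _]mul1mx -!f_psi scalerA -blockM mulmx1.
Qed.

Lemma asymptotic_linear : scalable f.
Proof.
move=> r x; rewrite [r]sum_block !scaler_suml raddf_sum.
by apply: eq_bigr => j _; exact: block_linear.
Qed.

End Layers.

Theorem theoremB (k : idomainType) (k_noeth : noetherian k)
    (A : algType k) (i : A -> A) (i_inv : k_involution i)
    (D : affine_cellular i)
    (D_idem : forall j : 'I_(ac_n D), idempotent_ideal (@layer k A i D j))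
    (D_det : forall j : 'I_(ac_n D),
       ~ zero_divisor (\det (swich (ac_cell j)))) :
  exists theta : {rmorphism A -> asymptotic D},
    [/\ theta =1 @Theta k A i D,
        injective theta
      & restriction_fully_faithful_on theta (@torsionless (asymptotic D))].
Proof.
exists (@Theta k A i D : {rmorphism A -> asymptotic D}).
split=> [//||X Y _ Y_torsionless]; first exact: Theta_inj.
apply: restrict_map_bij => g.
(* [g] is recast as an additive map between the original modules; its linearity over [A] is exactly
   compatibility with the scalars [Theta D a]. *)
have g_add : nmod_morphism (g : X -> Y).
  by split; [exact: (raddf0 g) | exact: (raddfD g)].
pose g' : {additive X -> Y} :=
  HB.pack (g : X -> Y) (GRing.isNmodMorphism.Build X Y g g_add).
have g_scal : scalable g'.
  apply: (asymptotic_linear D_det D_idem Y_torsionless) => a z.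
  exact: (linearZ_LR g a z).
by move=> r x y; rewrite -(g_scal r x); exact: (raddfD g').
Qed.
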